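(* Let $d\ge 2$ be an integer, $\gamma>1$, $p=d\gamma/2$, $\theta>0$, and $\kappa_\theta=p\,d^{p-1}\theta^p$. For $\boldsymbol A\in\operatorname{SPD}(d)$ define $$T_\theta(\boldsymbol A):=[\operatorname{tr}(\boldsymbol A)]^p-\kappa_\theta\log\det\boldsymbol A .$$ Then $T_\theta$ is strictly convex on $\operatorname{SPD}(d)$, and its unique minimizer on $\operatorname{SPD}(d)$ is $\theta\boldsymbol I$.
   Context: $\operatorname{SPD}(d)$ denotes the convex cone of real symmetric positive-definite $d\times d$ matrices, and $\boldsymbol I$ is the $d\times d$ identity matrix. *)

(* Defs.v *)
From HB Require Import structures.
From mathcomp Require Import all_boot all_order all_algebra.
From mathcomp Require Import all_classical all_reals all_analysis.

Set Implicit Arguments.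
Unset Strict Implicit.
Unset Printing Implicit Defensive.

Import Order.TTheory GRing.Theory Num.Theory.

Local Open Scope classical_set_scope.
Local Open Scope ring_scope.
Local Open Scope convex_scope.

Definition SPD (R : realType) (d : nat) : set 'M[R]_d :=
  [set A | A \is symmetricmx /\
           forall x : 'cV[R]_d, x != 0 -> 0 < (x^T *m A *m x) 0 0].

(* Strict counterpart of [convex_function]; unlike it, this includes the
   convexity of the domain. *)
Definition strictly_convex_function (R : numFieldType) (E : lmodType R)
    (E' := convex_lmodType E) (D : set E') (f : E' -> R^o) : Prop :=
  convex_set D /\
  forall t : {i01 R}, 0 < t%:num -> t%:num < 1 ->
    {in D &, forall x y : E', x != y -> f (x <| t |> y) < f x <| t |> f y}.

Definition is_minimizer (R : numDomainType) (E : Type) (D : set E)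
    (f : E -> R) (x : E) : Prop :=
  D x /\ forall y, D y -> f x <= f y.

Definition kappa (R : realType) (d : nat) (p theta : R) : R :=
  p * d%:R `^ (p - 1) * theta `^ p.

Definition Tfun (R : realType) (d : nat) (p theta : R) (A : 'M[R]_d) : R :=
  (\tr A) `^ p - kappa d p theta * ln (\det A).

(* Main.v *)
Require Import Defs.
From mathcomp Require Import all_boot all_order all_algebra.
From mathcomp Require Import all_classical all_reals all_analysis.
From mathcomp Require Import ring lra.

(** The proof produces, at every positive-definite [C], an affine function that
    agrees with [T] at [C] and lies strictly below [T] at every other
    positive-definite matrix ([Tfun_tangent]).  Its slope is the gradient
    [Tgrad C = p (tr C)^(p-1) I - kappa C^-1].  Supporting affine functions of
    this kind at all points give strict convexity
    ([strictly_convex_of_tangent]); and at [C = theta I] the gradient vanishes,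
    the constant [kappa] being chosen for exactly that, so that [T] is strictly
    larger everywhere else ([Tgrad_scalar]).

    The bound for [tr^p] is the tangent-line inequality of [x |-> x^p], an
    instance of Young's inequality.  The strictness comes from [- ln det], via
    [ln (det X) <= tr X - n] with equality only at [X = I] ([ln_det_leif]).
    That inequality is proved by induction on the size, without eigenvalues: if
    [a] is the upper left entry of [X], [S] its Schur complement and [a w] the
    rest of its first column, then [det X = a det S] and
    [tr X = a + tr S + a |w|^2], so the claim follows from the one for [S] and
    from [ln a <= a - 1].  The tangent inequality at a general [C = L L^T] is
    this one applied to [X = L^-1 A L^-T]. *)

Set Implicit Arguments.
Unset Strict Implicit.

Import Order.TTheory GRing.Theory Num.Theory.

Local Open Scope ring_scope.

(** * Positive-definite matrices *)

Section SPDTheory.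
Context {R : realType}.

Lemma symmetricmxE n (A : 'M[R]_n) : (A \is symmetricmx) = (A^T == A).
Proof. by rewrite is_hermitianmxE expr0 scale1r map_mx_id// eq_sym. Qed.

Lemma SPD_trmx {n} {A : 'M[R]_n} : SPD A -> A^T = A.
Proof. by case; rewrite symmetricmxE => /eqP. Qed.

Lemma SPD_congr n (M A : 'M[R]_n) :
  M \in unitmx -> SPD A -> SPD (M *m A *m M^T).
Proof.
move=> Mu sA; split.
  by rewrite symmetricmxE !trmx_mul trmxK (SPD_trmx sA) mulmxA.
move=> x x0.
have -> : x^T *m (M *m A *m M^T) *m x = (M^T *m x)^T *m A *m (M^T *m x).
  by rewrite trmx_mul trmxK !mulmxA.
apply: sA.2; apply: contra_neq x0 => Mx0.
by rewrite -[x]mul1mx -trmx1 -(mulmxV Mu) trmx_mul -mulmxA Mx0 mulmx0.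
Qed.

Lemma SPD_drblock m n (P : 'M[R]_m) (Q : 'M[R]_(m, n)) Q' (S : 'M[R]_n) :
  SPD (block_mx P Q Q' S) -> SPD S.
Proof.
move=> sB; split.
  move: (SPD_trmx sB); rewrite tr_block_mx => /eq_block_mx[_ _ _ Ssym].
  by rewrite symmetricmxE Ssym.
move=> x x0; have := sB.2 (col_mx 0 x).
rewrite tr_col_mx mul_row_block mul_row_col !trmx0 !mul0mx mulmx0 !add0r.
by apply; apply: contra_neq x0; rewrite -col_mx0 => /eq_col_mx[].
Qed.

Lemma SPD_diag_gt0 n (A : 'M[R]_n) i : SPD A -> 0 < A i i.
Proof.
move=> sA; have := sA.2 (delta_mx i 0).
rewrite trmx_delta -rowE -colE !mxE; apply; apply/eqP.
by move/matrixP/(_ i 0); rewrite !mxE !eqxx => /eqP; rewrite oner_eq0.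
Qed.

Lemma SPD_mxtrace_gt0 n (A : 'M[R]_n) : (0 < n)%N -> SPD A -> 0 < \tr A.
Proof.
case: n A => // n A _ sA; rewrite /mxtrace big_ord_recl ltr_pwDl ?SPD_diag_gt0//.
by apply: sumr_ge0 => i _; rewrite ltW ?SPD_diag_gt0.
Qed.

Lemma SPD_scalar n (a : R) : 0 < a -> SPD (a%:M : 'M[R]_n).
Proof.
move=> a0; split=> [|x x0]; first by rewrite symmetricmxE tr_scalar_mx.
rewrite mul_mx_scalar -scalemxAl mxE pmulr_rgt0// mxE.
under eq_bigr do rewrite mxE -expr2.
rewrite lt_def sumr_ge0 ?andbT; last by move=> i _; exact: sqr_ge0.
apply: contra_neq x0 => /eqP; rewrite psumr_eq0 => [|i _]; last exact: sqr_ge0.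
move/allP => x_eq0; apply/colP => i; rewrite mxE; apply/eqP.
by rewrite -sqrf_eq0 (implyP (x_eq0 i _)) ?mem_index_enum.
Qed.

Lemma SPD_comb n (A B : 'M[R]_n) (s t : R) :
  0 < s -> 0 < t -> SPD A -> SPD B -> SPD (s *: A + t *: B).
Proof.
move=> s0 t0 sA sB; split=> [|x x0].
  by rewrite symmetricmxE linearD !linearZ/= (SPD_trmx sA) (SPD_trmx sB).
rewrite mulmxDr mulmxDl -!scalemxAr -!scalemxAl.
rewrite mxE [X in X + _]mxE [X in _ + X]mxE.
by rewrite addr_gt0// pmulr_rgt0//; [exact: sA.2|exact: sB.2].
Qed.

(** * Schur complements and the Cholesky factorization *)

Definition shear n (w : 'cV[R]_n) : 'M[R]_(1 + n) := block_mx 1%:M 0 w 1%:M.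

Lemma det_shear n (w : 'cV[R]_n) : \det (shear w) = 1.
Proof. by rewrite det_lblock !det1 mulr1. Qed.

Lemma shear_unitmx n (w : 'cV[R]_n) : shear w \in unitmx.
Proof. by rewrite unitmxE det_shear unitr1. Qed.

Lemma mul_shearN n (w : 'cV[R]_n) : shear w *m shear (- w) = 1%:M.
Proof.
rewrite mulmx_block !mul1mx !mulmx1 !mul0mx !mulmx0 !addr0 subrr add0r.
by rewrite -scalar_mx_block.
Qed.

(** One step of symmetric Gaussian elimination: the shear with
    [w = A_{i0} / A_{00}] clears the first row and column, and what remains is
    the Schur complement [S], positive definite as a diagonal block of a matrix
    congruent to [A].  Inductions on the size of [A] go through this lemma. *)
Lemma SPD_schur n (A : 'M[R]_(1 + n)) : SPD A ->
  exists a w S, [/\ 0 < a, SPD S &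
    A = shear w *m block_mx a%:M 0 0 S *m (shear w)^T].
Proof.
move=> sA; pose a := A 0 0; pose v := dlsubmx A; pose w := a^-1 *: v.
have a0 : 0 < a by exact: SPD_diag_gt0.
have defA : A = block_mx a%:M v^T v (drsubmx A).
  rewrite -[LHS]submxK; congr block_mx.
    rewrite [LHS]mx11_scalar !mxE; congr (A _ _)%:M; exact/val_inj.
  by rewrite trmx_dlsub (SPD_trmx sA).
have aw : a *: w = v by rewrite scalerA divff ?scale1r// gt_eqF.
pose S := drsubmx A - w *m v^T.
have defB : shear (- w) *m A *m (shear (- w))^T = block_mx a%:M 0 0 S.
  rewrite defA tr_block_mx !mulmx_block !trmx1 !trmx0.
  rewrite !mul1mx !mulmx1 !mul0mx !mulmx0 !addr0 mul_mx_scalar.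
  rewrite linearN/= mul_scalar_mx !scalerN -linearZ/= aw !addNr.
  by rewrite mul0mx add0r mulNmx addrC.
have sB : SPD (block_mx (a%:M : 'M[R]_1) 0 0 S).
  by rewrite -defB; apply: SPD_congr => //; exact: shear_unitmx.
exists a, w, S; split=> //; first exact: SPD_drblock sB.
rewrite -defB !mulmxA mul_shearN mul1mx -mulmxA -trmx_mul mul_shearN.
by rewrite trmx1 mulmx1.
Qed.

Lemma SPD_cholesky n (A : 'M[R]_n) :
  SPD A -> exists2 L : 'M[R]_n, L \in unitmx & A = L *m L^T.
Proof.
elim: n A => [A|n IHn]; last rewrite -[n.+1]/(1 + n)%N => A.
  by exists 1%:M; [exact: unitmx1|apply/matrixP => -[]].
move=> /SPD_schur[a [w [S [a0 /IHn[L Lu ->] ->]]]].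
exists (shear w *m block_mx (Num.sqrt a)%:M 0 0 L).
  rewrite unitmx_mul shear_unitmx/= unitmxE det_ublock det_scalar1.
  by rewrite unitrM -[X in _ && X]unitmxE Lu unitfE gt_eqF ?sqrtr_gt0.
rewrite trmx_mul !mulmxA -[in RHS](mulmxA (shear w)); congr (_ *m _ *m _).
rewrite tr_block_mx mulmx_block !trmx0 !mulmx0 !mul0mx !addr0 add0r.
by rewrite tr_scalar_mx -scalar_mxM -expr2 sqr_sqrtr// ltW.
Qed.

Lemma SPD_unitmx n (A : 'M[R]_n) : SPD A -> A \in unitmx.
Proof.
by move=> /SPD_cholesky[L Lu ->]; rewrite unitmx_mul unitmx_tr Lu.
Qed.

Lemma SPD_det_gt0 n (A : 'M[R]_n) : SPD A -> 0 < \det A.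
Proof.
move=> sA; have := SPD_unitmx sA; case/SPD_cholesky: sA => L _ ->.
rewrite unitmxE unitfE det_mulmx det_tr -expr2 => d0.
by rewrite lt_def d0 sqr_ge0.
Qed.

(** * The tangent inequality of the logarithm of the determinant *)

Lemma ln_leif (x : R) : 0 < x -> ln x <= x - 1 ?= iff (x == 1).
Proof.
move=> x0; apply/leifP; case: eqVneq => [->|x1]; first by rewrite ln1 subrr.
have : ln x != 0 by rewrite ln_eq0.
by move=> /expR_gt1Dx; rewrite lnK ?posrE// ltrBrDl.
Qed.

(** The eigenvalue proof would sum [ln l <= l - 1] over the spectrum; the
    pivots of the elimination do as well, since their product is still the
    determinant and the trace exceeds their sum by a nonnegative quantity that
    vanishes only when nothing was there to eliminate. *)
Lemma ln_det_leif n (A : 'M[R]_n) :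
  SPD A -> ln (\det A) <= \tr A - n%:R ?= iff (A == 1%:M).
Proof.
elim: n A => [A|n IHn]; last rewrite -[n.+1]/(1 + n)%N => A.
  rewrite [A]flatmx0 det_mx00 ln1 /mxtrace big_ord0 subrr => _.
  by rewrite [_%:M]flatmx0 eqxx; exact/leif_refl.
move=> /SPD_schur[a [w [S [a0 sS ->]]]].
have -> : \det (shear w *m block_mx a%:M 0 0 S *m (shear w)^T) = a * \det S.
  by rewrite !det_mulmx det_tr det_shear mul1r mulr1 det_ublock det_scalar1.
have -> : shear w *m block_mx a%:M 0 0 S *m (shear w)^T =
    block_mx a%:M (a *: w^T) (a *: w) (a *: (w *m w^T) + S) :> 'M[R]_(1 + n).
  rewrite tr_block_mx !mulmx_block !trmx1 !trmx0.
  rewrite !mul1mx !mulmx1 !mul0mx !mulmx0 !addr0 !add0r mul_mx_scalar.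
  by rewrite mul_scalar_mx -scalemxAl.
have sum_leif : 0 <= a * \tr (w *m w^T) ?= iff (w == 0).
  apply/leifP; case: eqVneq => [->|w0]; first by rewrite mul0mx mxtrace0 mulr0.
  rewrite mulr_gt0// mxtrace_mulC [w^T *m w]mx11_scalar mxtrace_scalar.
  by have := (SPD_scalar n ltr01).2 w w0; rewrite mulmx1.
rewrite lnM ?posrE ?SPD_det_gt0//.
have := leifD (leifD (ln_leif a0) (IHn S sS)) sum_leif.
rewrite addr0 mxtrace_block mxtraceD mxtraceZ mxtrace_scalar mulr1n.
rewrite (_ : a - 1 + _ + _ =
  a + (a * \tr (w *m w^T) + \tr S) - (1 + n)%:R); last by rewrite natrD; ring.
rewrite (@scalar_mx_block _ 1 n).
congr (_ <= _ ?= iff _).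
apply/andP/eqP => [[/andP[/eqP-> /eqP->] /eqP->]|].
  by rewrite mul0mx trmx0 !scaler0 add0r.
move=> /eq_block_mx[/matrixP/(_ 0 0)]; rewrite !mxE eqxx !mulr1n => a1 _.
rewrite a1 !scale1r => w0; rewrite w0 mul0mx add0r => ->.
by rewrite !eqxx.
Qed.

(** Strict concavity of [ln det], in the form of its first-order condition.
    The congruence by [L^-1], where [C = L L^T], moves [C] to the identity,
    which reduces the claim to [ln_det_leif]. *)
Lemma ln_det_tangent n (A C : 'M[R]_n) : SPD A -> SPD C -> A != C ->
  ln (\det A) < ln (\det C) + \tr (invmx C *m (A - C)).
Proof.
move=> sA sC AC; have Cu := SPD_unitmx sC.
have [L Lu defC] := SPD_cholesky sC.
pose M := invmx L; have Mu : M \in unitmx by rewrite unitmx_inv.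
have MC : M *m C *m M^T = 1%:M.
  by rewrite defC mulmxA mulVmx// mul1mx -trmx_mul mulVmx// trmx1.
have MTu : M^T \in unitmx by rewrite unitmx_tr.
have invC : invmx C = M^T *m M.
  rewrite -[RHS](mulmxK Cu) [in X in X *m invmx C]defC.
  by rewrite -(mulmxA M^T) (mulKmx Lu) -trmx_mul mulmxV// trmx1 mul1mx.
have MA1 : M *m A *m M^T != 1%:M.
  apply: contra_neq AC => MA; apply: (can_inj (mulKmx Mu)).
  by apply: (can_inj (mulmxK MTu)); rewrite MA MC.
have /leifP := ln_det_leif (SPD_congr Mu sA).
rewrite (negbTE MA1) mxtrace_mulC mulmxA -invC.
have dC := SPD_det_gt0 sC.
have -> : \det (M *m A *m M^T) = \det A / \det C.
  apply: (mulIf (lt0r_neq0 dC)); rewrite divfK ?gt_eqF// -[RHS]mul1r.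
  by rewrite -[in RHS](det1 R n) -MC !det_mulmx; ring.
rewrite ln_div ?posrE//; last exact: SPD_det_gt0.
by rewrite ltrBlDl mulmxBr mulVmx// linearB/= mxtrace1.
Qed.

(** * Powers, and convexity from supporting affine functions *)

(** Young's inequality for [y] and [x^(p-1)] with exponents [p] and
    [q = p / (p - 1)]: as [(p - 1) q = p], it reads
    [y x^(p-1) <= y^p / p + (1 - 1/p) x^p]. *)
Lemma powR_tangent (p x y : R) : 1 < p -> 0 < x -> 0 <= y ->
  x `^ p + p * x `^ (p - 1) * (y - x) <= y `^ p.
Proof.
move=> p1 x0 y0; have p0 : 0 < p by exact: lt_trans p1.
have q0 : 0 < (1 - p^-1)^-1 by rewrite invr_gt0 subr_gt0 invf_lt1.
have := conjugate_powR y0 (powR_ge0 x (p - 1)) p0 q0.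
rewrite invrK addrC subrK => /(_ erefl).
rewrite -powRrM (_ : (p - 1) * _ = p); last first.
  by field; rewrite gt_eqF//= subr_eq0 gt_eqF.
rewrite -(ler_pM2l p0) -(mulr_powRB1 (ltW x0) p0).
have -> : p * (y `^ p / p + x * x `^ (p - 1) * (1 - p^-1)) =
  y `^ p + (p - 1) * (x * x `^ (p - 1)) by field; rewrite gt_eqF.
lra.
Qed.

(** At the convex combination [C] of [A] and [B], the two supporting
    inequalities at [C] are weighted and added; the linear terms cancel since
    [A - C] and [B - C] are opposite multiples of [A - B].  The pairing with a
    matrix under the trace stands for an arbitrary linear form. *)
Lemma strictly_convex_of_tangent n (D : set 'M[R]_n) (f : 'M[R]_n -> R)
    (G : 'M[R]_n -> 'M[R]_n) :
  convex_set (D : set (convex_lmodType 'M[R]_n)) ->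
  (forall A C, D A -> D C -> A != C -> f C + \tr (G C *m (A - C)) < f A) ->
  strictly_convex_function D f.
Proof.
move=> cD fG; split=> // t t0 t1 A B /set_mem DA /set_mem DB AB.
pose s : R := t%:num; pose C : 'M[R]_n := s *: A + (1 - s) *: B.
have DC : D C by exact: set_mem (cD A B t (mem_set DA) (mem_set DB)).
have s0 : 0 < s by []. have s1 : 0 < 1 - s by rewrite subr_gt0.
have AC : A - C = (1 - s) *: (A - B).
  by apply/matrixP => i j; rewrite !mxE; ring.
have BC : B - C = (- s) *: (A - B).
  by apply/matrixP => i j; rewrite !mxE; ring.
have AB0 : A - B != 0 by rewrite subr_eq0.
have fA := fG A C DA DC; have fB := fG B C DB DC.
rewrite -subr_eq0 AC scaler_eq0 negb_or AB0 gt_eqF// in fA.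
rewrite -subr_eq0 BC scaler_eq0 negb_or AB0 oppr_eq0 gt_eqF// in fB.
move: (fA isT) (fB isT); rewrite -!scalemxAr !mxtraceZ => {}fA {}fB.
rewrite convRE -/s; change (f C < s * f A + (1 - s) * f B).
nra.
Qed.

(** * The functional T *)

Lemma convex_SPD d : convex_set (@SPD R d : set (convex_lmodType 'M[R]_d)).
Proof.
apply/convex_setW => A B /set_mem sA /set_mem sB k k0 k1; apply/mem_set.
by apply: SPD_comb => //; rewrite subr_gt0.
Qed.

Definition Tgrad d (p theta : R) (C : 'M[R]_d) : 'M[R]_d :=
  (p * \tr C `^ (p - 1))%:M - kappa d p theta *: invmx C.

Lemma Tfun_tangent d (p theta : R) (A C : 'M[R]_d) :
  (0 < d)%N -> 1 < p -> 0 < theta -> SPD A -> SPD C -> A != C ->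
  Tfun p theta C + \tr (Tgrad p theta C *m (A - C)) < Tfun p theta A.
Proof.
move=> d0 p1 theta0 sA sC AC.
have p0 : 0 < p by exact: lt_trans p1.
have k0 : 0 < kappa d p theta by rewrite !mulr_gt0 ?powR_gt0 ?ltr0n.
have := powR_tangent p1 (SPD_mxtrace_gt0 d0 sC) (ltW (SPD_mxtrace_gt0 d0 sA)).
have := ln_det_tangent sA sC AC.
rewrite -(ltr_pM2l k0) mulmxBl mul_scalar_mx -scalemxAl [X in _ + X < _]linearB/=.
rewrite !mxtraceZ [\tr (A - C)]linearB/= /Tfun.
lra.
Qed.

(** [kappa = p d^(p-1) theta^p] balances the two terms of the gradient:
    [p (d theta)^(p-1) = kappa / theta]. *)
Lemma Tgrad_scalar d (p theta : R) :
  (0 < d)%N -> 0 < p -> 0 < theta -> Tgrad p theta (theta%:M : 'M[R]_d) = 0.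
Proof.
move=> d0 p0 theta0.
rewrite /Tgrad mxtrace_scalar -mulr_natl invmx_scalar scale_scalar_mx -raddfB/=.
rewrite /kappa powRM ?ler0n ?ltW// -(mulr_powRB1 (ltW theta0) p0).
rewrite (_ : _ - _ = 0) ?raddf0//; field; exact: lt0r_neq0.
Qed.

End SPDTheory.

Unset Implicit Arguments.

Theorem theorem3p2 (R : realType) (d : nat) (gamma p theta : R)
    (hd : (2 <= d)%N) (hgamma : 1 < gamma) (hp : p = d%:R * gamma / 2)
    (htheta : 0 < theta) :
  strictly_convex_function (@SPD R d) (Tfun p theta) /\
  unique (is_minimizer (@SPD R d) (Tfun p theta)) theta%:M.
Proof.
have d0 : (0 < d)%N by exact: leq_trans hd.
have p1 : 1 < p.
  have : (2%:R : R) <= d%:R by rewrite ler_nat.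
  by rewrite hp; nra.
have p0 : 0 < p by exact: lt_trans p1.
have sI : SPD (theta%:M : 'M[R]_d) by exact: SPD_scalar.
split.
  apply: (@strictly_convex_of_tangent _ _ _ _ (Tgrad p theta)).
    exact: convex_SPD.
  by move=> A C sA sC AC; exact: Tfun_tangent.
have min_lt (A : 'M[R]_d) :
    SPD A -> A != theta%:M -> Tfun p theta (theta%:M : 'M[R]_d) < Tfun p theta A.
  move=> sA AI; have := Tfun_tangent d0 p1 htheta sA sI AI.
  by rewrite Tgrad_scalar// mul0mx mxtrace0 addr0.
split.
  split=> // A sA; have [->//|AI] := eqVneq A theta%:M.
  by rewrite ltW ?min_lt.
move=> A [sA minA]; apply/esym/eqP; apply: contraT => AI.
by have := minA _ sI; rewrite leNgt min_lt.
Qed.
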